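(* Let $k_1 \ge k_2 \ge 2$ be integers. Then every digraph $D$ with $\delta^+(D) \ge k_1 + 3k_2 - 5$ contains a subdivision of $C(k_1,k_2)$; that is, $\mathrm{mader}_{\delta^+}(C(k_1,k_2)) \le k_1+3k_2-5$.
   Context: Digraphs are finite, loopless, have no parallel arcs, but may contain digons. $C(k_1,k_2)$ denotes the oriented cycle consisting of two vertices $x,y$ and two internally vertex-disjoint directed paths from $x$ to $y$ of lengths $k_1$ and $k_2$. A subdivision of a digraph $F$ is obtained by replacing each arc $(u,v)$ of $F$ by a directed $u$-$v$-path, with paths for different arcs internally vertex-disjoint. $\mathrm{mader}_{\delta^+}(F)$ is the smallest integer $m$ such that every digraph of minimum out-degree at least $m$ contains a subdivision of $F$. *)

(* Defs.v *)
From mathcomp Require Import all_boot.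
Set Implicit Arguments. Unset Strict Implicit. Unset Printing Implicit Defensive.

(* A digraph is a finite vertex type V with an arc relation E : rel V.
   A relation automatically has no parallel arcs; digons (E u v && E v u) are
   allowed. Looplessness is the predicate [loopless E]. *)
Definition loopless (V : finType) (E : rel V) : Prop := forall v, ~~ E v v.

Definition outdeg (V : finType) (E : rel V) (v : V) : nat := #|[set w | E v w]|.
Definition min_outdeg_ge (V : finType) (E : rel V) (m : nat) : Prop :=
  forall v, m <= outdeg E v.

Definition contains_subdivision (VF : finType) (EF : rel VF)
    (V : finType) (E : rel V) : Prop :=
  exists (phi : VF -> V) (P : VF -> VF -> seq V),
    [/\ injective phi,
        (forall u v, EF u v ->
           [/\ path E (phi u) (rcons (P u v) (phi v)),
               uniq (phi u :: rcons (P u v) (phi v)) &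
               forall w, w \in P u v -> forall z, phi z != w]) &
        (forall u v u' v', EF u v -> EF u' v' -> (u, v) != (u', v') ->
           forall w, w \in P u v -> w \notin P u' v')].

(* The oriented cycle C(k1,k2) on vertex set 'I_(k1+k2):
   x = 0, y = 1; the first x-y path is 0 -> 2 -> 3 -> ... -> k1 -> 1
   (length k1), the second is 0 -> k1+1 -> ... -> k1+k2-1 -> 1 (length k2). *)
Definition cpath1 (k1 : nat) : seq nat := 0 :: rcons (iota 2 k1.-1) 1.
Definition cpath2 (k1 k2 : nat) : seq nat := 0 :: rcons (iota k1.+1 k2.-1) 1.
Definition consec (s : seq nat) (a b : nat) : bool := (a, b) \in zip s (behead s).

Definition C_arc (k1 k2 : nat) : rel 'I_(k1 + k2) :=
  fun a b => consec (cpath1 k1) a b || consec (cpath2 k1 k2) a b.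

(* Main.v *)
Require Import Defs.
From mathcomp Require Import all_boot zify.
From Stdlib Require Import Classical.

Set Implicit Arguments. Unset Strict Implicit. Unset Printing Implicit Defensive.

(* A fork is a path [h] to a vertex [x] followed by two disjoint arms [s] and
   [t] from [x], each of length [k2 - 1]; take one with [h] as long as possible.
   Call a vertex heavy if it has more than [k1 - k2] out-neighbours on [h].
   If both arms can be prolonged disjointly to heavy vertices, then one of the
   two ends sees the first out-neighbour of either on [h], while the other sees
   a vertex of [h] at least [k1 - k2] steps further: this closes a [C(k1, k2)].
   Otherwise, by Menger's theorem, one vertex [v] separates the ends of the arms
   from the heavy vertices. From an arm end other than [v] one then reaches,
   avoiding [v] and the fork, only non-heavy vertices; these keep enough
   out-neighbours off [h] to grow a new fork at that arm end, with a longer [h]. *)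

(** * Menger's theorem for two disjoint paths *)

Definition linked (V : finType) (e : rel V) (A H : {set V}) : Prop :=
  exists a p b q,
    [/\ a \in A, path e a p & last a p \in H] /\
    [/\ b \in A, path e b q, last b q \in H & ~~ has (mem (a :: p)) (b :: q)].

(** Required for every [v], this says that no single vertex separates [A] from [H]. Here and in
    [linked], paths may repeat vertices; [linked_shorten] removes the repetitions. *)
Definition joined_off (V : finType) (e : rel V) (A H : {set V}) (v : V) : Prop :=
  exists a p, [/\ a \in A, path e a p, last a p \in H & v \notin a :: p].

Definition del_arc (V : finType) (e : rel V) (x y : V) : rel V :=
  [rel a b | e a b && ((a, b) != (x, y))].

Lemma del_arc_sub (V : finType) (e : rel V) (x y a : V) (p : seq V) :
  path (del_arc e x y) a p -> path e a p.
Proof. by apply: sub_path => u v /= /andP[]. Qed.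

(** In the second case the path is cut just before its first use of the arc. *)
Lemma del_arc_prefix (V : finType) (e : rel V) (x y a : V) (p : seq V) :
  path e a p ->
  path (del_arc e x y) a p \/
  exists p1 p2,
    [/\ p = p1 ++ y :: p2, path (del_arc e x y) a p1 & last a p1 = x].
Proof.
set e' := del_arc e x y.
elim: p a => [|b p IHp] a /=; first by left.
case/andP=> eab /IHp IH.
have [[-> ->]|neq] := eqVneq (a, b) (x, y); first by right; exists [::], p.
have e'ab : e' a b by rewrite /e' /del_arc /= eab.
case: IH => [pp|[p1 [p2 [-> pp1 lp1]]]]; first by left; rewrite e'ab.
by right; exists (b :: p1), p2; rewrite /= e'ab pp1.
Qed.

(** In the second case the path is cut just after its last use of the arc. *)
Lemma del_arc_suffix (V : finType) (e : rel V) (x y a : V) (p : seq V) :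
  path e a p ->
  path (del_arc e x y) a p \/
  exists p1 p2, p = p1 ++ y :: p2 /\ path (del_arc e x y) y p2.
Proof.
set e' := del_arc e x y.
elim: p a => [|b p IHp] a /=; first by left.
case/andP=> eab /IHp[pp|[p1 [p2 [-> pp2]]]]; last by right; exists (b :: p1), p2.
have [[_ <-]|neq] := eqVneq (a, b) (x, y); first by right; exists [::], p.
by left; rewrite /= pp andbT /e' /del_arc /= eab neq.
Qed.

Lemma linked_shorten (V : finType) (e : rel V) (A H : {set V}) :
  linked e A H -> exists a p b q,
    [/\ a \in A, path e a p, last a p \in H & uniq (a :: p)] /\
    [/\ b \in A, path e b q, last b q \in H, uniq (b :: q)
       & ~~ has (mem (a :: p)) (b :: q)].
Proof.
case=> a [p [b [q [[aA pp]]]]]; case/shortenP: pp => p' pp' up' sp' lp'.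
case=> bA pq; case/shortenP: pq => q' pq' uq' sq' lq' dis.
exists a, p', b, q'; do 2!split=> //; apply: contra dis => /hasP[w wq wp].
apply/hasP; exists w.
  by move: wq; rewrite !inE => /orP[->//|/sq' ->]; rewrite orbT.
by move: wp; rewrite /= !inE => /orP[->//|/sp' ->]; rewrite orbT.
Qed.

Lemma uniq_path_splitl (V : finType) (e : rel V) (a w : V) (p : seq V) :
  path e a p -> uniq (a :: p) -> w \in a :: p -> w != last a p ->
  exists p1, [/\ path e a p1, last a p1 = w & last a p \notin a :: p1].
Proof.
move=> pp up wp; case/splitPl: wp pp up => p1 p2 lp1.
rewrite cat_path last_cat lp1 -cat_cons cat_uniq => /andP[pp1 _] /and3P[_ dis _] wl.
exists p1; split=> //; apply: contra dis => lin; apply/hasP; exists (last w p2) => //.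
by case: p2 wl {lin} => [|c p2] /=; rewrite ?eqxx ?mem_last.
Qed.

Lemma uniq_path_splitr (V : finType) (e : rel V) (a w : V) (p : seq V) :
  path e a p -> uniq (a :: p) -> w \in a :: p -> w != a ->
  exists p2, [/\ path e w p2, last w p2 = last a p & a \notin w :: p2].
Proof.
move=> pp up wp wa; case/splitPl: wp pp up => p1 p2 lp1.
rewrite cat_path last_cat lp1 => /andP[_ pp2] /= /andP[ap _].
exists p2; split=> //; rewrite inE negb_or eq_sym wa.
by apply: contra ap; rewrite mem_cat orbC => ->.
Qed.

(* Goering's proof of Menger's theorem, for two paths: deleting the arc [xy]
   either keeps the connectivity or creates a one-vertex separator [z], and then
   pairs of paths from [A] to [{z, x}] and from [{z, y}] to [H] can be glued. *)
Lemma menger2 (V : finType) (e : rel V) (A H : {set V}) (v0 : V) :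
  (forall v, joined_off e A H v) -> linked e A H.
Proof.
have [n] := ubnP #|[set ab : V * V | e ab.1 ab.2]|.
elim: n e A H => // n IHn e A H lt_n sep.
have [[x y] /= exy|noarc] := pickP (fun ab : V * V => e ab.1 ab.2); last first.
  (* Without arcs every path is a single vertex: avoiding [v0] gives one vertex of [A] in [H], and
     avoiding that vertex gives a second. *)
  have nopath a p : path e a p -> p = [::].
    by case: p => // b p /= /andP[eab _]; move: (noarc (a, b)); rewrite /= eab.
  have [a [p [aA /nopath-> /= aH _]]] := sep v0.
  have [b [q [bA /nopath-> /= bH]]] := sep a.
  rewrite inE => nab; exists a, [::], b, [::].
  by do 2!split=> //=; rewrite !inE orbF eq_sym.
set e' := del_arc e x y.
have lt_e' : #|[set ab : V * V | e' ab.1 ab.2]| < n.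
  rewrite -ltnS; apply: leq_trans lt_n; rewrite ltnS; apply: proper_card.
  apply/properP; split.
    by apply/subsetP=> ab; rewrite !inE /= => /andP[].
  by exists (x, y); rewrite !inE /e' /del_arc //= eqxx andbF.
have [sep'|nsep] := classic (forall v, joined_off e' A H v).
  have [a [p [b [q [[aA pp lp] [bA pq lq dis]]]]]] := IHn _ _ _ lt_e' sep'.
  by exists a, p, b, q; do 2!split=> //; apply: del_arc_sub; eassumption.
have [z zsep] := not_all_ex_not _ _ nsep.
have zon a p : a \in A -> path e' a p -> last a p \in H -> z \in a :: p.
  by move=> aA pp lp; apply: contra_notT zsep => zp; exists a, p.
have [a1 [p1 [a2 [p2 [[a1A pp1 lp1 up1] [a2A pp2 lp2 up2 dp]]]]]] :
    exists a p b q,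
    [/\ a \in A, path e' a p, last a p = z & uniq (a :: p)] /\
    [/\ b \in A, path e' b q, last b q = x, uniq (b :: q)
       & ~~ has (mem (a :: p)) (b :: q)].
  (* An [e]-path from [A] to [H] off [v] either survives in [e'], hence meets [z], or reaches [x]
     before using the deleted arc. Its prefix up to there ends in [z] or [x]. *)
  have : linked e' A [set z; x].
    apply: IHn lt_e' _ => v; have [a [p [aA pp lp vp]]] := sep v.
    have [pp'|[q1 [q2 [pE pq1 lq1]]]] := del_arc_prefix x y pp; last first.
      exists a, q1; split; rewrite ?lq1 ?set22 //.
      by apply: contra vp; rewrite pE -cat_cons mem_cat => ->.
    have zp := zon _ _ aA pp' lp; case/splitPl: zp pp' vp => q1 q2 lq1.
    rewrite cat_path => /andP[pq1 _] vp.
    exists a, q1; split; rewrite ?lq1 ?set21 //.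
    by apply: contra vp; rewrite -cat_cons mem_cat => ->.
  case/linked_shorten=> a [p [b [q [[aA pp lp up] [bA pq lq uq dis]]]]].
  (* Disjoint paths have distinct ends, so one ends at [z] and the other at [x]. *)
  have nl : last a p != last b q.
    apply: contra dis => /eqP lE; apply/hasP; exists (last b q); rewrite ?mem_last //.
    by rewrite -lE /= mem_last.
  move: lp lq nl; rewrite !inE => /orP[]/eqP lp /orP[]/eqP lq; rewrite ?lp ?lq ?eqxx // => _.
    by exists a, p, b, q.
  by exists b, q, a, p; do 2!split=> //; rewrite has_sym.
have [q1 [q2 [[pq1 lq1 uq1] [pq2 lq2 uq2 dq]]]] :
    exists p q,
    [/\ path e' z p, last z p \in H & uniq (z :: p)] /\
    [/\ path e' y q, last y q \in H, uniq (y :: q)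
       & ~~ has (mem (z :: p)) (y :: q)].
  (* Mirror image: the suffix is kept, from [z] or from [y] after the last use of the arc. *)
  have : linked e' [set z; y] H.
    apply: IHn lt_e' _ => v; have [a [p [aA pp lp vp]]] := sep v.
    have [pp'|[r1 [r2 [pE pr2]]]] := del_arc_suffix x y pp; last first.
      exists y, r2; split; rewrite ?set22 //; first by rewrite pE last_cat in lp.
      by apply: contra vp; rewrite pE !inE mem_cat inE => ->; rewrite !orbT.
    have zp := zon _ _ aA pp' lp; case/splitPl: zp pp' lp vp => r1 r2 lr1.
    rewrite cat_path last_cat lr1 => /andP[_ pr2] lr2 vp.
    exists z, r2; split; rewrite ?set21 //.
    apply: contra vp; rewrite -cat_cons mem_cat !inE => /orP[/eqP->|->].
      by rewrite -lr1 -in_cons mem_last.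
    by rewrite orbT.
  case/linked_shorten=> a [p [b [q [[aA pp lp up] [bA pq lq uq dis]]]]].
  have nl : a != b.
    apply: contra dis => /eqP lE; apply/hasP; exists b; rewrite ?mem_head //.
    by rewrite -lE /= mem_head.
  move: aA bA nl pp lp up pq lq uq dis; rewrite !inE.
  move=> /orP[]/eqP-> /orP[]/eqP->; rewrite ?eqxx // => _ *.
    by exists p, q.
  by exists q, p; do 2!split=> //; rewrite has_sym.
(* One path runs through [z], the other through the restored arc from [x] to [y]. *)
exists a1, (p1 ++ q1), a2, (p2 ++ y :: q2).
have z1 : z \in a1 :: p1 by rewrite -lp1 mem_last.
split; split=> //.
- by rewrite cat_path (del_arc_sub pp1) lp1 (del_arc_sub pq1).
- by rewrite last_cat lp1.
- by rewrite cat_path (del_arc_sub pp2) lp2 /= exy (del_arc_sub pq2).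
- by rewrite last_cat.
apply/hasPn=> w; rewrite -cat_cons mem_cat => w2.
change (w \notin (a1 :: p1) ++ q1); rewrite mem_cat.
(* If the first half of one path met the second half of the other, switching there would give an
   [e']-path from [A] to [H] avoiding [z]. *)
have glue a p b q : a \in A -> path e' a p -> path e' b q -> last b q \in H ->
    last a p = b -> z \notin a :: p -> z \notin b :: q -> False.
  move=> aA pp pq lq lE zp zq.
  have := zon a (p ++ q) aA; rewrite cat_path pp lE pq last_cat lE lq -cat_cons.
  rewrite mem_cat (negPf zp) => /(_ isT isT) zq'.
  by move: zq; rewrite inE (zq' : z \in q) orbT.
have z2 : z \notin a2 :: p2.
  by apply: contra dp => zp; apply/hasP; exists z.
have zq2 : z \notin y :: q2.
  by apply: contra dq => zq; apply/hasP; exists z => //; apply: mem_head.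
apply/negP=> /orP[w1|w1]; case/orP: w2 => w2.
- by move/negP: dp; apply; apply/hasP; exists w.
- have wz : w != last a1 p1 by rewrite lp1; apply: contraNneq zq2 => <-.
  have [r [pr lr]] := uniq_path_splitl pp1 up1 w1 wz; rewrite lp1 => zr.
  case/splitPl: w2 pq2 lq2 zq2 => s1 s2 ls1.
  rewrite cat_path last_cat ls1 -cat_cons mem_cat negb_or.
  move=> /andP[_ ps] ls /andP[zs1 zs2].
  apply: (glue a1 r w s2) => //; rewrite inE negb_or zs2 andbT.
  by apply: contraNneq zs1 => ->; rewrite -ls1 mem_last.
- have wz : w != z.
    by apply: contraNneq z2 => <-.
  have [r [pr lr zr]] := uniq_path_splitr pq1 uq1 (mem_behead (s := z :: q1) w1) wz.
  case/splitPl: w2 pp2 z2 => s1 s2 ls1.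
  rewrite cat_path -cat_cons mem_cat negb_or => /andP[ps _] /andP[zs _].
  by apply: (glue a2 s1 w r); rewrite ?lr.
- by move/negP: dq; apply; apply/hasP; exists w; rewrite //= inE w1 orbT.
Qed.

(** * Greedy path growth and counting *)

(** Each chosen vertex is added to [X], which keeps the path simple and leaves [#|X| + n] invariant.
    The start has its own degree condition because it may lie outside [W]; as there are no loops,
    [u] itself is not counted in [X]. *)
Lemma grow_path (V : finType) (E : rel V) (W L : {set V}) (d n : nat)
    (X : {set V}) (u : V) :
  loopless E ->
  (forall a b, a \in L -> E a b -> b \in W -> b \in L) ->
  (forall a, a \in L -> a \in W -> d <= #|[set b in W | E a b]|) ->
  u \in L -> (0 < n -> #|X :\ u| < #|[set b in W | E u b]|) ->
  #|X| + n <= d.+1 ->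
  exists p, [/\ size p = n, path E u p, uniq p &
    forall w, w \in p -> [/\ w \in W, w \in L & w \notin X]].
Proof.
move=> noloop closed degL; elim: n X u => [|n IHn] X u uL degu leX.
  by exists [::].
have /subsetPn[r] : ~~ ([set b in W | E u b] \subset X :\ u).
  by apply/negP=> /subset_leq_card; rewrite leqNgt degu.
rewrite !inE => /andP[rW Eur].
have -> /= : r != u by apply: contraTneq Eur => ->.
move=> rX; have rL := closed u r uL Eur rW.
have [||p [sp pp up inp]] := IHn (r |: X) r rL.
- rewrite setU1K // => n0; apply: leq_trans (degL r rL rW); lia.
- by rewrite cardsU1 rX; lia.
exists (r :: p); split=> //=; first by rewrite sp.
- by rewrite Eur.
- by rewrite up andbT; apply/negP=> /inp[_ _]; rewrite !inE eqxx.
move=> w; rewrite inE => /orP[/eqP->//|/inp[wW wL]].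
by rewrite !inE negb_or => /andP[_ ->].
Qed.

Lemma card_le_split_seq (V : finType) (A : {set V}) (s : seq V) :
  #|A| <= size s + #|[set w in A | w \notin s]|.
Proof.
rewrite -(cardsID [set w in s] A) leq_add //.
  apply: leq_trans (card_size s); apply: subset_leq_card; apply/subsetP=> w.
  by rewrite !inE => /andP[].
by apply: subset_leq_card; apply/subsetP=> w; rewrite !inE andbC.
Qed.

Lemma pick_outside (V : finType) (A : {set V}) (s : seq V) :
  size s < #|A| -> exists2 w, w \in A & w \notin s.
Proof.
move=> lt_s; have /subsetPn[w wA ws] : ~~ (A \subset s).
  apply/negP=> /subset_leq_card/leq_trans/(_ (card_size s)).
  by rewrite leqNgt lt_s.
by exists w.
Qed.

(** * Subdivisions of [C(k1, k2)] from two internally disjoint paths *)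

Lemma consec_iota (z c n e a b : nat) :
  consec (z :: rcons (iota c n.+1) e) a b ->
  [\/ a = z /\ b = c, [/\ c <= a, a < c + n & b = a.+1] | a = c + n /\ b = e].
Proof.
rewrite /consec; elim: n z c => [|n IHn] z c; rewrite /= !inE.
  case/orP=> /eqP[-> ->]; first by constructor 1.
  by rewrite addn0; constructor 3.
case/orP=> [/eqP[-> ->]|/IHn []]; first by constructor 1.
- by case=> -> ->; constructor 2; split; lia.
- by case=> *; constructor 2; split; lia.
- by case=> -> ->; constructor 3; split; lia.
Qed.

(** With both lengths at least 2, the inner labels run from [2] to [k1.+2] on the first path and
    from [k1.+3] to [(k1 + k2).+3] on the second. *)
Lemma C_arc_cases (k1 k2 : nat) (u v : 'I_(k1.+2 + k2.+2)) : C_arc u v ->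
  [\/ u = 0 :> nat /\ v = 2 :> nat,
      exists j, [/\ j < k1, u = j.+2 :> nat & v = j.+3 :> nat] |
      u = k1.+2 :> nat /\ v = 1 :> nat] \/
  [\/ u = 0 :> nat /\ v = k1.+3 :> nat,
      exists j, [/\ j < k2, u = (k1 + j).+3 :> nat & v = (k1 + j.+1).+3 :> nat] |
      u = (k1 + k2).+3 :> nat /\ v = 1 :> nat].
Proof.
case/orP=> /consec_iota[] => [uv|[le_u lt_u vE]|[-> ->]|uv|[le_u lt_u vE]|[-> ->]].
- by left; constructor 1.
- by left; constructor 2; exists (u - 2); split; lia.
- by left; constructor 3.
- by right; constructor 1.
- by right; constructor 2; exists (u - k1.+3); split; lia.
- by right; constructor 3.
Qed.

Lemma path_cat_rcons (V : finType) (E : rel V) (x y : V) (s s' : seq V) (n : nat) :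
  size s = n.+1 -> path E x (rcons (s ++ s') y) ->
  [/\ E x (nth x s 0), forall j, j < n -> E (nth x s j) (nth x s j.+1) &
      path E (nth x s n) (rcons s' y)].
Proof.
move=> sz; rewrite rcons_cat cat_path => /andP[/(pathP x) ps].
rewrite (last_nth x) sz; split=> //; first by apply: (ps 0); rewrite sz.
by move=> j lt_j; apply: (ps j.+1); rewrite sz.
Qed.

(** The paths may be too long: the first [k1.-1] and [k2.-1] inner vertices serve as branch
    vertices, and the excess subdivides only the two arcs into [y]. *)
Lemma contains_subdivision_C (k1 k2 : nat) (V : finType) (E : rel V)
    (x y : V) (s t : seq V) :
  2 <= k2 -> k2 <= k1 -> k1.-1 <= size s -> k2.-1 <= size t ->
  path E x (rcons s y) -> path E x (rcons t y) -> uniq (x :: y :: s ++ t) ->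
  contains_subdivision (@C_arc k1 k2) E.
Proof.
move=> hk2 hk12 le_s le_t.
rewrite -[s](cat_take_drop k1.-1) -[t](cat_take_drop k2.-1).
have ss : size (take k1.-1 s) = k1.-1 by apply: size_takel.
have st : size (take k2.-1 t) = k2.-1 by apply: size_takel.
move: (take k1.-1 s) (drop k1.-1 s) (take k2.-1 t) (drop k2.-1 t) ss st.
move=> {le_s le_t}s s' {}t t' ss st ps pt.
(* From here on [k1] and [k2] denote the original values minus 2. *)
move=> U; case: k1 k2 hk2 hk12 ss st => [|[|k1]] [|[|k2]] // _ hk12 /= ss st.
pose l := x :: y :: s ++ t.
have Ul' : perm_eq (x :: y :: (s ++ s') ++ t ++ t') (l ++ s' ++ t').
  by rewrite /l /= !perm_cons -!catA perm_cat2l perm_catCA.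
move: U; rewrite (perm_uniq Ul') cat_uniq => /and3P[Ul /hasPn dl].
rewrite cat_uniq => /and3P[Us' /hasPn ds Ut'].
have sl : size l = k1.+2 + k2.+2 by rewrite /= size_cat; lia.
pose phi (i : 'I_(k1.+2 + k2.+2)) := nth x l i.
pose P (i j : 'I_(k1.+2 + k2.+2)) :=
  if i == k1.+2 :> nat then s' else if i == (k1 + k2).+3 :> nat then t' else [::].
have phil i : phi i \in l by rewrite mem_nth // sl.
have phi_inj : injective phi.
  by move=> i j /eqP; rewrite nth_uniq ?sl // => /eqP/val_inj.
have Pl u v w : w \in P u v -> w \notin l.
  rewrite /P; case: ifP => _; last case: ifP => // _; move=> w_in; apply: dl;
  by rewrite mem_cat w_in ?orbT.
have uP u v : uniq (P u v) by rewrite /P; do 2!case: ifP => // _.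
have [ps0 ps1 ps2] := path_cat_rcons ss ps.
have [pt0 pt1 pt2] := path_cat_rcons st pt.
have phis (i : 'I_(k1.+2 + k2.+2)) j : j <= k1 -> i = j.+2 :> nat -> phi i = nth x s j.
  by move=> lt_j ij; rewrite /phi ij /= nth_cat ss ltnS lt_j.
have phit (i : 'I_(k1.+2 + k2.+2)) j : i = (k1 + j).+3 :> nat -> phi i = nth x t j.
  by move=> ij; rewrite /phi ij /= -addSn nth_cat ss ltnNge leq_addr /= addKn.
have phi0 (i : 'I_(k1.+2 + k2.+2)) : i = 0 :> nat -> phi i = x by rewrite /phi => ->.
have phi1 (i : 'I_(k1.+2 + k2.+2)) : i = 1 :> nat -> phi i = y by rewrite /phi => ->.
have Ps (u v : 'I_(k1.+2 + k2.+2)) : u = k1.+2 :> nat -> P u v = s'.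
  by rewrite /P => ->; rewrite eqxx.
have Pt (u v : 'I_(k1.+2 + k2.+2)) : u = (k1 + k2).+3 :> nat -> P u v = t'.
  have /eqP/negPf neq : (k1 + k2).+3 <> k1.+2 by clear; lia.
  by rewrite /P => ->; rewrite neq eqxx.
have P0 (u v : 'I_(k1.+2 + k2.+2)) :
    u <> k1.+2 :> nat -> u <> (k1 + k2).+3 :> nat -> P u v = [::].
  by rewrite /P => /eqP/negPf-> /eqP/negPf->.
have arcs u v : C_arc u v ->
    [/\ path E (phi u) (rcons (P u v) (phi v)), u <> v :> nat &
        P u v <> [::] -> v = 1 :> nat].
  case/C_arc_cases=> [] [[u0 v2]|[j [lt_j uj vj]]|[uk v1]].
  - by rewrite P0 ?u0 // (phi0 u) // (phis v 0) //= ps0 v2.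
  - rewrite P0; [|by clear -lt_j uj; lia..].
    by rewrite (phis u j (ltnW lt_j)) // (phis v j.+1) //= ps1 // uj vj; split=> //; apply: n_Sn.
  - by rewrite (Ps u) // (phis u k1) // (phi1 v) // v1 uk.
  - by rewrite P0 ?u0 // (phi0 u) // (phit v 0) ?addn0 //= pt0 v2.
  - rewrite P0; [|by clear -lt_j uj; lia..].
    by rewrite (phit u j) // (phit v j.+1) //= pt1 // uj vj addnS; split=> //; apply: n_Sn.
  - by rewrite (Pt u) // (phit u k2) // (phi1 v) // v1 uk.
exists phi, P; split=> // [u v Euv|u v u' v' Euv Euv' neq w].
  have [puv uv _] := arcs u v Euv; split=> //.
    have nP i : phi i \notin P u v by apply/negP=> /Pl; rewrite phil.
    rewrite /= mem_rcons inE rcons_uniq uP negb_or !nP !andbT.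
    by apply/eqP=> /phi_inj/(congr1 val).
  by move=> w /Pl wl z; apply: contraNneq wl => <-.
have [_ _ v1] := arcs u v Euv; have [_ _ v1'] := arcs u' v' Euv'.
move=> wu; apply/negP=> wu'.
(* Subdivided arcs both end at label [1]; being distinct, they have different tails, so one carries
   [s'] and the other [t']. *)
have vv : v = v'.
  by apply: val_inj; rewrite /= v1 ?v1' // => Pnil; [move: wu'|move: wu]; rewrite Pnil.
have {neq} uu : u <> u' :> nat.
  by move/val_inj=> uu; move: neq; rewrite uu vv eqxx.
have in_s'_t' z : z \in s' -> z \in t' -> False by move=> zs /ds/negP.
move: wu wu'; rewrite /P.
case: eqP => us; [|case: eqP => // ut]; (case: eqP => us'; [|case: eqP => // ut']).
- by case: uu; rewrite us us'.
- exact: in_s'_t'.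
- by move=> wt ws; apply: (in_s'_t' w).
- by case: uu; rewrite ut ut'.
Qed.

(** * Closing a cycle at two heavy vertices *)

(** The end of [t] sees some [y] beyond the first [k1 - k2] vertices of [p :: g]. Going from [x]
    along [s], then from [p] to [y], passes at least [k2.-1 + (k1 - k2) = k1.-1] inner vertices; the
    other path goes along [t] and straight to [y]. *)
Lemma subdivision_of_heavy_end (k1 k2 : nat) (V : finType) (E : rel V)
    (x p : V) (g s t : seq V) :
  2 <= k2 -> k2 <= k1 -> k2.-1 <= size s -> k2.-1 <= size t ->
  path E p g -> path E x s -> path E x t -> uniq ((p :: g) ++ x :: s ++ t) ->
  E (last x s) p -> k1 - k2 < #|[set w in p :: g | E (last x t) w]| ->
  contains_subdivision (@C_arc k1 k2) E.
Proof.
move=> hk2 hk12 le_s le_t pg ps pt U Esp; set d := k1 - k2 => heavy.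
have lt_take : size (take d (p :: g)) < #|[set w in p :: g | E (last x t) w]|.
  by rewrite (leq_ltn_trans _ heavy) // size_take_min geq_minl.
have [y] := pick_outside lt_take.
rewrite inE => /andP[yg Ety] ytake.
have ydrop : y \in drop d (p :: g).
  by move: yg; rewrite -{1}(cat_take_drop d (p :: g)) mem_cat (negPf ytake).
have lt_d : d < size (p :: g).
  by rewrite ltnNge; apply/negP=> /drop_oversize d0; rewrite d0 in ydrop.
have szd : size (take d (p :: g)) = d by rewrite size_takel // ltnW.
have [r [w [gE le_r]]] : exists r w, p :: g = r ++ y :: w /\ d <= size r.
  case/splitPr: ydrop (cat_take_drop d (p :: g)) => u w <-.
  by exists (take d (p :: g) ++ u), w; rewrite -catA size_cat szd leq_addr.
apply: (@contains_subdivision_C k1 k2 V E x y (s ++ r) t) => //.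
- by rewrite size_cat; lia.
- rewrite rcons_cat cat_path ps /=.
  have : path E (last x s) (p :: g) by rewrite /= Esp.
  by rewrite gE -cat_rcons cat_path => /andP[].
- by rewrite rcons_path pt.
have : uniq ((x :: y :: (s ++ r) ++ t) ++ w).
  rewrite -(perm_uniq (s1 := (p :: g) ++ x :: s ++ t)) // gE.
  by apply/permP=> a; rewrite /= !(count_cat, mem_cat) /= !count_cat; clear; lia.
by rewrite cat_uniq => /andP[].
Qed.

(** Cutting [h] at the first vertex seen by either end loses no out-neighbour of the two ends. The
    end that sees this vertex takes the role of [s] in [subdivision_of_heavy_end]. *)
Lemma subdivision_of_heavy_ends (k1 k2 : nat) (V : finType) (E : rel V)
    (x : V) (h s t : seq V) :
  2 <= k2 -> k2 <= k1 -> k2.-1 <= size s -> k2.-1 <= size t ->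
  sorted E (rcons h x) -> path E x s -> path E x t -> uniq (h ++ x :: s ++ t) ->
  k1 - k2 < #|[set w in h | E (last x s) w]| ->
  k1 - k2 < #|[set w in h | E (last x t) w]| ->
  contains_subdivision (@C_arc k1 k2) E.
Proof.
move=> hk2 hk12 le_s le_t hx ps pt U hs ht.
pose a w := E (last x s) w || E (last x t) w.
have has_a : has a h.
  have /card_gt0P[w] := leq_ltn_trans (leq0n _) hs.
  by rewrite inE => /andP[wh Ew]; apply/hasP; exists w; rewrite // /a Ew.
have [/(nth_find x) aP lt_i] := (has_a, has_a); rewrite has_find in lt_i.
set i := find a h in aP lt_i.
have sub (z : V) : (forall w, E z w -> a w) ->
    k1 - k2 < #|[set w in h | E z w]| -> k1 - k2 < #|[set w in drop i h | E z w]|.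
  move=> za /leq_trans; apply; apply: subset_leq_card; apply/subsetP=> w.
  rewrite !inE => /andP[wh Ezw]; rewrite Ezw andbT.
  move: (wh); rewrite -{1}(cat_take_drop i h) mem_cat => /orP[/index_ltn lt_w|//].
  by have := before_find x lt_w; rewrite nth_index // za.
have {}hs := sub _ (fun w Ew => introT orP (or_introl Ew)) hs.
have {sub}ht := sub _ (fun w Ew => introT orP (or_intror Ew)) ht.
have dE := drop_nth x lt_i; rewrite dE in hs ht.
have hE := cat_take_drop i h; rewrite dE in hE.
have pg : path E (nth x h i) (drop i.+1 h).
  move: hx; rewrite -cats1 -{1}hE -catA => /cat_sorted2[_].
  by rewrite /= cat_path => /andP[].
have Ug : uniq ((nth x h i :: drop i.+1 h) ++ x :: s ++ t).
  by move: U; rewrite -{1}hE -catA cat_uniq => /and3P[].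
case/orP: aP => [Es|Et]; first exact: subdivision_of_heavy_end Es ht.
apply: subdivision_of_heavy_end Et hs => //.
rewrite -(perm_uniq (s1 := (nth x h i :: drop i.+1 h) ++ x :: s ++ t)) //.
by apply/permP=> b; rewrite /= !(count_cat, mem_cat) /= !count_cat; clear; lia.
Qed.

(** * Forks and their lengthening *)

Definition is_fork (V : finType) (E : rel V) (h : seq V) (x : V) (s t : seq V) : Prop :=
  [/\ sorted E (rcons h x), path E x s, path E x t & uniq (h ++ x :: s ++ t)].

Lemma is_fork_sym (V : finType) (E : rel V) (h : seq V) (x : V) (s t : seq V) :
  is_fork E h x s t -> is_fork E h x t s.
Proof.
case=> hx ps pt U; split=> //; rewrite -(perm_uniq (s1 := h ++ x :: s ++ t)) //.
by rewrite perm_cat2l perm_cons perm_catC.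
Qed.

Lemma path_all (V : finType) (e : rel V) (P : pred V) (a : V) (p : seq V) :
  (forall u v, e u v -> P v) -> path e a p -> all P p.
Proof. by move=> eP; elim: p a => //= b p IHp a /andP[/eP-> /IHp]. Qed.

(* The side arms of the new fork start at the end of [s] and stay in [L]; only
   their last vertices may be [v] or lie on [t], and this is what the bound
   [k1 + 3 * k2 - 5] leaves room for. *)
Lemma longer_fork (k1 k2 : nat) (V : finType) (E : rel V)
    (h : seq V) (x : V) (s t : seq V) (v : V) (L : {set V}) :
  2 <= k2 -> k2 <= k1 -> loopless E -> min_outdeg_ge E (k1 + 3 * k2 - 5) ->
  is_fork E h x s t -> size s = k2.-1 -> size t = k2.-1 ->
  last x s \in L ->
  (forall a b, a \in L -> E a b -> b \notin v :: h ++ x :: s ++ t -> b \in L) ->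
  (forall a, a \in L -> #|[set w in h | E a w]| <= k1 - k2) ->
  exists h' x' s' t', [/\ is_fork E h' x' s' t', size s' = k2.-1,
    size t' = k2.-1 & size h < size h'].
Proof.
case/lastP: s => [|s0 z] hk2 hk12 noloop deg [hx ps pt U] szs szt.
  by rewrite /= in szs; lia.
have szs0 : size s0 = k2 - 2 by rewrite size_rcons in szs; lia.
rewrite last_rcons; set s := rcons s0 z in hx ps U szs * => zL closed light.
(* The new arms grow in [W]. Their last vertices are chosen from the larger [N u], which may contain
   [v] and vertices of [t]: the arm [t] is given up. *)
pose W := [set w | w \notin v :: h ++ x :: s ++ t].
pose N u := [set w | E u w & w \notin h ++ x :: s].
(* At most [k1 - k2] out-neighbours are lost on [h], one at [x], and those on [s]: [k2 - 1] in
   general, but only [k2 - 2] for [z], which is not its own out-neighbour. *)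
have degN' u r : u \in L -> (forall w, E u w -> w \in s -> w \in r) ->
    k1 + 3 * k2 - 5 <= k1 - k2 + (size r).+1 + #|N u|.
  move=> uL sr; apply: leq_trans (deg u) _; rewrite /outdeg.
  rewrite -(cardsID [set w in h]) -addnA leq_add //.
    apply: leq_trans (light u uL); apply: subset_leq_card; apply/subsetP=> w.
    by rewrite !inE andbC.
  apply: leq_trans (card_le_split_seq _ (x :: r)) _; rewrite leq_add2l.
  apply: subset_leq_card; apply/subsetP=> w; rewrite !inE mem_cat inE !negb_or.
  case/andP=> /andP[-> Euw] /andP[-> wr]; rewrite Euw /=.
  by apply: contra wr; apply: sr.
have degN u : u \in L -> 3 * k2 - 5 <= #|N u|.
  by move=> uL; have := degN' u s uL (fun _ _ => id); rewrite szs; lia.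
have degNz : 3 * k2 - 4 <= #|N z|.
  have := degN' z s0 zL; rewrite szs0.
  have sr w : E z w -> w \in s -> w \in s0.
    rewrite mem_rcons inE => Ezw /orP[/eqP wz|//].
    by move: (noloop z); rewrite -{2}wz Ezw.
  by move=> /(_ sr); lia.
have degW u : #|N u| <= k2 + #|[set b in W | E u b]|.
  apply: leq_trans (card_le_split_seq _ (v :: t)) _; rewrite /= szt prednK; last by lia.
  rewrite leq_add2l; apply: subset_leq_card; apply/subsetP=> w.
  rewrite !inE !mem_cat !inE mem_cat !negb_or.
  by case/andP=> /and3P[-> -> /andP[-> ->]] /andP[-> ->].
have closedW a b : a \in L -> E a b -> b \in W -> b \in L.
  by rewrite inE; apply: closed.
have degLW a : a \in L -> a \in W -> 2 * k2 - 5 <= #|[set b in W | E a b]|.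
  by move=> aL _; have := degN a aL; have := degW a; lia.
have degzW : 2 * k2 - 4 <= #|[set b in W | E z b]| by have := degW z; lia.
have [||p [szp pp up inp]] := grow_path (n := k2 - 2) (X := set0) noloop closedW degLW zL.
- by move=> k20; rewrite set0D cards0; lia.
- by rewrite cards0; lia.
have cardp : #|[set w in p]| <= k2 - 2.
  by rewrite cardsE -szp; apply: card_size.
(* The second arm must avoid the first, and [2 * (k2 - 2)] is just within the bound [2 * k2 - 5 + 1]
   when [k2 > 2]. *)
have [||q [szq pq uq inq]] :=
  grow_path (n := k2 - 2) (X := [set w in p]) noloop closedW degLW zL.
- move=> k20; have := subset_leq_card (subD1set [set w in p] z); lia.
- by lia.
(* This leaves room to avoid [p ++ q] and one further vertex. If [k2 = 2], then [r] is empty and the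
   extra out-neighbour of [z] is needed; otherwise [3 * k2 - 5 > 2 * k2 - 3]. *)
have degEnd r : size r = k2 - 2 -> (forall w, w \in r -> w \in L) ->
    2 * k2 - 3 < #|N (last z r)|.
  case: r => [/= szr _|a r szr rL].
    by apply: leq_trans degNz; move: hk2 szr; clear; lia.
  apply: leq_trans (degN _ (rL _ (mem_last a r))).
  by move: szr; clear; rewrite /=; lia.
have pL w : w \in p -> w \in L by case/inp.
have qL w : w \in q -> w \in L by case/inq.
have szpq : size (p ++ q) = 2 * k2 - 4.
  by rewrite size_cat szp szq; move: hk2; clear; lia.
have [|w1 w1N w1pq] := @pick_outside _ (N (last z p)) (p ++ q).
  by apply: leq_ltn_trans (degEnd p szp pL); rewrite szpq; clear; lia.
have [|w2 w2N w2pq] := @pick_outside _ (N (last z q)) (w1 :: p ++ q).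
  by apply: leq_ltn_trans (degEnd q szq qL); rewrite /= szpq; move: hk2; clear; lia.
have := w1N; have := w2N; rewrite !inE => /andP[Ew2 w2o] /andP[Ew1 w1o].
(* The old arm [s] is absorbed into the path, with its end [z] as the new branching vertex. *)
exists (h ++ x :: s0), z, (rcons p w1), (rcons q w2); split; rewrite ?size_rcons ?szp ?szq.
- split; rewrite ?rcons_path ?pp ?pq //.
    rewrite rcons_cat rcons_cons -/s -cat_rcons; move: hx.
    by case: (h) => //= a h'; rewrite cat_path last_rcons => ->.
  have -> : uniq ((h ++ x :: s0) ++ z :: rcons p w1 ++ rcons q w2) =
            uniq ((h ++ x :: s) ++ w2 :: w1 :: p ++ q).
    apply: perm_uniq; apply/permP=> a; rewrite /s -!cats1.
    by do 3!rewrite ?count_cat /=; clear; lia.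
  rewrite cat_uniq; apply/and3P; split.
  + by move: U; rewrite -cat_cons catA cat_uniq => /and3P[].
  + have WF w : w \in W -> w \notin h ++ x :: s.
      rewrite inE; apply: contra.
      by rewrite inE !mem_cat !inE mem_cat => /or3P[]->; rewrite ?orbT.
    apply/hasPn=> w; rewrite !inE mem_cat => /or4P[/eqP->|/eqP->|/inp[+ _ _]|/inq[+ _ _]] //;
    exact: WF.
  + rewrite /= w2pq w1pq cat_uniq up uq andbT; apply/hasPn=> w /inq[_ _].
    by rewrite inE.
- by move: hk2; clear; lia.
- by move: hk2; clear; lia.
- by rewrite size_cat /=; clear; lia.
Qed.

Lemma fork_step (k1 k2 : nat) (V : finType) (E : rel V)
    (h : seq V) (x : V) (s t : seq V) :
  2 <= k2 -> k2 <= k1 -> loopless E -> min_outdeg_ge E (k1 + 3 * k2 - 5) ->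
  is_fork E h x s t -> size s = k2.-1 -> size t = k2.-1 ->
  contains_subdivision (@C_arc k1 k2) E \/
  exists h' x' s' t', [/\ is_fork E h' x' s' t', size s' = k2.-1,
    size t' = k2.-1 & size h < size h'].
Proof.
move=> hk2 hk12 noloop deg fk szs szt.
(* Only heads of arcs must be off the fork, so that paths can start at the ends of its arms. *)
pose e := [rel a b | E a b && (b \notin h ++ x :: s ++ t)].
pose A := [set last x s; last x t].
pose H := [set u | k1 - k2 < #|[set w in h | E u w]|].
have eE a p : path e a p -> path E a p by apply: sub_path => u w /= /andP[].
have eout a p : path e a p -> all [predC h ++ x :: s ++ t] p.
  by apply: path_all => u w /= /andP[].
have [sep|/not_all_ex_not[v nsep]] := classic (forall v, joined_off e A H v).
  left.
  have glue p q : path e (last x s) p -> path e (last x t) q ->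
      last (last x s) p \in H -> last (last x t) q \in H ->
      uniq p -> uniq q -> ~~ has (mem p) q -> contains_subdivision (@C_arc k1 k2) E.
    move=> pp pq lp lq up uq dis; case: fk => hx ps pt U.
    apply: (@subdivision_of_heavy_ends k1 k2 V E x h (s ++ p) (t ++ q)) => //.
    - by rewrite size_cat szs leq_addr.
    - by rewrite size_cat szt leq_addr.
    - by rewrite cat_path ps eE.
    - by rewrite cat_path pt eE.
    - rewrite -(perm_uniq (s1 := (h ++ x :: s ++ t) ++ p ++ q)); last first.
        by apply/permP=> b; rewrite !(count_cat, mem_cat) /= !count_cat; clear; lia.
      rewrite cat_uniq U cat_uniq up uq dis !andbT -all_predC all_cat.
      by rewrite (eout _ _ pp) (eout _ _ pq).
    - by move: lp; rewrite inE last_cat.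
    - by move: lq; rewrite inE last_cat.
  have [a [p [b [q [[aA pp lp up] [bA pq lq uq dis]]]]]] := linked_shorten (menger2 x sep).
  (* Disjoint paths start at different vertices of [A], so each arm is prolonged by exactly one of
     them. *)
  have nab : a != b.
    by apply: contra dis => /eqP->; apply/hasP; exists b; apply: mem_head.
  have dpq : ~~ has (mem p) q.
    apply: contra dis => /hasP[w wq wp]; apply/hasP.
    by exists w; rewrite /= inE ?(wp : w \in p) ?wq orbT.
  case/andP: up => _ up; case/andP: uq => _ uq.
  move: aA bA nab pp lp pq lq; rewrite !in_set2.
  move=> /orP[]/eqP-> /orP[]/eqP->; rewrite ?eqxx // => _ pp lp pq lq.
    exact: (glue p q).
  by apply: (glue q p); rewrite // has_sym.
right.
(* [L] consists of the vertices reachable from [z] off [v] and the fork. A heavy vertex in it would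
   give a path from [A] to [H] missing [v]. *)
have reach z : z \in A -> z != v -> exists L : {set V}, [/\ z \in L,
    forall a b, a \in L -> E a b -> b \notin v :: h ++ x :: s ++ t -> b \in L &
    forall a, a \in L -> #|[set w in h | E a w]| <= k1 - k2].
  move=> zA zv; pose e' := [rel a b | E a b && (b \notin v :: h ++ x :: s ++ t)].
  exists [set u | connect e' z u]; split; first by rewrite inE connect0.
    move=> a b; rewrite !inE => za Eab bF; apply: connect_trans za (connect1 _).
    by rewrite /= Eab inE bF.
  move=> a; rewrite inE leqNgt => /connectP[p pp ->]; apply/negP=> heavy.
  case: nsep; exists z, p; split=> //; last 1 first.
  - rewrite inE eq_sym negb_or zv /=.
    have /allP pv : all (predC1 v) p.
      by apply: path_all pp => u w /= /andP[_]; rewrite inE negb_or => /andP[].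
    by apply/negP=> /pv; rewrite /= eqxx.
  - apply: sub_path pp => u w /= /andP[->]; by rewrite inE negb_or => /andP[].
  - by rewrite inE.
(* The arms are nonempty and disjoint, so [v] ends at most one of them; if it ends [s], the arms are
   exchanged. *)
have [sv|sv] := eqVneq (last x s) v; last first.
  have [|L [zL closed light]] := reach (last x s) _ sv; first exact: set21.
  exact: longer_fork fk szs szt zL closed light.
have tv : last x t != v.
  case: fk => _ _ _; rewrite -sv cat_uniq /= cat_uniq => /and5P[_ _ _ _ /andP[/hasPn dst _]].
  have [s0 t0] : 0 < size s /\ 0 < size t by lia.
  have ls : last x s \in s by case: (s) s0 => //= a r _; apply: mem_last.
  have lt : last x t \in t by case: (t) t0 => //= a r _; apply: mem_last.
  by apply: contraNneq (dst _ lt) => ->.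
have [|L [zL closed light]] := reach (last x t) _ tv; first exact: set22.
apply: (longer_fork (v := v)) (is_fork_sym fk) szt szs zL _ light => // a b aL Eab bF.
apply: closed aL Eab _; apply: contra bF.
by rewrite !(inE, mem_cat) [(b \in t) || _]orbC.
Qed.

(** * Initial fork and induction on the length of [h] *)

Theorem theorem1p8 (k1 k2 : nat) (hk2 : 2 <= k2) (hk12 : k2 <= k1)
    (V : finType) (E : rel V) (hV : 0 < #|V|) (hloop : loopless E)
    (hdeg : min_outdeg_ge E (k1 + 3 * k2 - 5)) :
  contains_subdivision (@C_arc k1 k2) E.
Proof.
have step h x s t : is_fork E h x s t -> size s = k2.-1 -> size t = k2.-1 ->
    contains_subdivision (@C_arc k1 k2) E.
  (* The vertices of [h] are distinct, so [h] cannot be lengthened forever. *)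
  have [n] := ubnP (#|V| - size h); elim: n h x s t => // n IHn h x s t lt_n fk szs szt.
  have [//|[h' [x' [s' [t' [fk' szs' szt' lt_h]]]]]] :=
    fork_step hk2 hk12 hloop hdeg fk szs szt.
  apply: (IHn h' x' s' t') => //.
  have : size h' <= #|V|.
    case: fk' => _ _ _; rewrite cat_uniq => /andP[uh' _].
    by rewrite -(card_uniqP uh') max_card.
  lia.
(* The first fork has empty [h]: both arms grow greedily from an arbitrary vertex, with [W] and [L]
   the whole vertex set. *)
have /card_gt0P[x _] := hV.
have closed a b : a \in setT -> E a b -> b \in setT -> b \in setT by [].
have degT a : a \in setT -> a \in setT -> k1 + 3 * k2 - 5 <= #|[set b in setT | E a b]|.
  by move=> _ _; apply: leq_trans (hdeg a) _; apply/subset_leq_card/subsetP=> w; rewrite !inE.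
have xT : x \in setT by [].
have [||s [szs ps us ins]] := grow_path (n := k2.-1) (X := [set x]) hloop closed degT xT.
- by move=> _; rewrite setDv cards0; apply: leq_trans (degT x xT xT); lia.
- by rewrite cards1; lia.
have cards : #|[set w in s]| <= k2.-1.
  by rewrite cardsE -szs; apply: card_size.
have xs : x \notin [set w in s].
  by rewrite inE; apply/negP=> /ins[_ _]; rewrite inE eqxx.
have [||t [szt pt ut int]] :=
  grow_path (n := k2.-1) (X := x |: [set w in s]) hloop closed degT xT.
- move=> _; rewrite setU1K //; apply: leq_trans (degT x xT xT); lia.
- by rewrite cardsU1 xs; lia.
apply: (step [::] x s t) => //; split=> //=.
rewrite cat_uniq us ut mem_cat negb_or andbT; move: xs; rewrite inE => ->.
apply/andP; split; first by apply/negP=> /int[_ _]; rewrite !inE eqxx.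
by apply/hasPn=> w /int[_ _]; rewrite !inE negb_or => /andP[].
Qed.
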